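(* Let $N\geq 2$ and let $\rho$ be the unique positive real root of $X^N-X^{N-1}-\cdots-X-1$. Let $x>y$ be consecutive $\rho$-integers (i.e. no $\rho$-integer lies strictly between $y$ and $x$). (1) If $y=0$, then $x=1$. (2) Suppose $y\neq 0$. Write the normal form representations of $x$ and $y$ (as formal sums of distinct powers $\rho^j$, $j\geq0$) as $x=z+\tilde x$ and $y=z+\tilde y$, where $z$ is the sum of the terms $\rho^j$ common to both representations with exponent $j$ larger than the largest exponent at which the two representations differ, and $\tilde x,\tilde y$ are the sums of the remaining terms. If $\tilde y=0$, then $\tilde x=1$. If $\tilde y\neq 0$, then $\tilde x$ has higher degree than $\tilde y$, and, denoting by $n$ the degree of $\tilde y$ and by $r$ the remainder upon division of $n+1$ by $N$, \[ x-y=\sum_{i=r+1}^N\rho^{r-i}=\frac1\rho+\cdots+\frac1{\rho^{N-r}}. \]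
   Context: A non-negative real number is a $\rho$-integer if it equals $\sum_{i=0}^{n}c_i\rho^{n-i}$ for some $n\in\mathbb N_0$ and $c_i\in\{0,1\}$. A representation $\rho^n+\sum_{i=1}^n c_i\rho^{n-i}$ with $c_i\in\{0,1\}$ is in normal form if, setting $c_0=1$ and $c_k=0$ for $k>n$, every block $c_j,\dots,c_{j+N-1}$ ($j\ge0$) of $N$ consecutive coefficients contains a zero. Every nonzero $\rho$-integer has a unique normal form representation; the degree of a nonzero $\rho$-integer (or of such a partial sum) is the largest exponent of $\rho$ occurring in it. *)

(* Defs.v *)
From HB Require Import structures.
From mathcomp Require Import all_boot all_order all_algebra.
From mathcomp Require Import reals.

Set Implicit Arguments.
Unset Strict Implicit.
Unset Printing Implicit Defensive.

Import Order.TTheory GRing.Theory Num.Theory.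
Local Open Scope ring_scope.

(* X^N - X^(N-1) - ... - X - 1 *)
Definition nbonacci_poly (R : realType) (N : nat) : {poly R} :=
  'X^N - \sum_(i < N) 'X^i.

Definition rho_integer (R : realType) (rho x : R) : Prop :=
  0 <= x /\ exists (n : nat) (c : nat -> bool),
    x = \sum_(i < n.+1) (c i)%:R * rho ^+ (n - i).

Definition consecutive (R : realType) (rho y x : R) : Prop :=
  [/\ rho_integer rho y, rho_integer rho x, y < x &
      forall w : R, rho_integer rho w -> ~ (y < w < x)].

Definition normal_coefs (N n : nat) (c : nat -> bool) : Prop :=
  [/\ c 0%N = true,
      forall k : nat, (n < k)%N -> c k = false &
      forall j : nat, exists2 i : nat, (j <= i < j + N)%N & c i = false].

(* A formal sum of distinct powers of rho is encoded as the polynomial with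
   coefficients in {0, 1} in which 'X stands for rho.  Coefficients c_i are
   indexed from the leading term down, so c_i multiplies 'X^(n - i). *)
Definition formal_sum (R : realType) (n : nat) (c : nat -> bool) : {poly R} :=
  \sum_(i < n.+1) (c i)%:R *: 'X^(n - i).

Definition normal_form_of (R : realType) (N : nat) (rho x : R)
    (p : {poly R}) : Prop :=
  exists (n : nat) (c : nat -> bool),
    [/\ normal_coefs N n c, p = formal_sum R n c & x = p.[rho]].

Definition largest_difference (R : realType) (p q : {poly R}) (m : nat) : Prop :=
  p`_m <> q`_m /\ forall j : nat, (m < j)%N -> p`_j = q`_j.

Definition common_terms_above (R : realType) (p q : {poly R}) (m : nat) :
    {poly R} :=
  \sum_(m.+1 <= j < size p | (p`_j == 1) && (q`_j == 1)) 'X^j.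

(* Largest exponent occurring; meaningful for p <> 0 only. *)
Definition deg (R : realType) (p : {poly R}) : nat := (size p).-1.

(* Main.v *)
(** Write rho-integers as values p.[rho] of polynomials with coefficients in
    {0, 1}.  Among those of size at most k without N consecutive ones, the value
    is maximal for the string 1^(N-1) 0 1^(N-1) 0 ... read from the top, and it
    falls short of rho^k by 1/rho + ... + 1/rho^(N - k mod N) > 0.
    Hence a normal form has size at most k iff its value is less than rho^k.
    If m is the largest exponent at which the normal forms of x > y differ,
    removing the common terms above m leaves consecutive rho-integers whose
    values are separated by rho^m; so the larger one is rho^m, and the smaller
    one, being its predecessor, is the maximal string of length m. *)
Require Import Defs.
From mathcomp Require Import all_boot all_order all_algebra.
From mathcomp Require Import reals.
From mathcomp Require Import zify lra.

Set Implicit Arguments.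
Unset Strict Implicit.
Unset Printing Implicit Defensive.

Import Order.TTheory GRing.Theory Num.Theory.
Local Open Scope ring_scope.

Section DigitPoly.
Variable R : nzSemiRingType.
Implicit Types p q : {poly R}.

Definition digit_poly p : Prop := forall j, exists b : bool, p`_j = b%:R.

Definition admissible (N : nat) p : Prop :=
  digit_poly p /\ forall j, exists2 i, (j <= i < j + N)%N & p`_i = 0.

Lemma digit_poly_poly n (a : nat -> bool) :
  digit_poly (\poly_(j < n) (a j)%:R).
Proof.
move=> j; rewrite coef_poly.
by case: ifP => _; [exists (a j) | exists false].
Qed.

Lemma digit_polyXn m : digit_poly 'X^m.
Proof. by move=> j; exists (j == m); rewrite coefXn. Qed.

Lemma digit_poly_addMXn p q m : (size p <= m)%N ->
  digit_poly p -> digit_poly q -> digit_poly (p + q * 'X^m).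
Proof.
move=> size_p digit_p digit_q j; rewrite coefD coefMXn.
case: ltnP => [_|mj]; first by rewrite addr0.
by rewrite nth_default ?add0r // (leq_trans size_p).
Qed.

Lemma digit_poly_take p m : digit_poly p -> digit_poly (take_poly m p).
Proof.
by move=> digit_p j; rewrite coef_take_poly; case: ifP => // _; exists false.
Qed.

Lemma admissible_take N p m : admissible N p -> admissible N (take_poly m p).
Proof.
move=> [digit_p zero_p]; split=> [|j]; first exact: digit_poly_take.
have [i jiN pi0] := zero_p j.
by exists i; rewrite ?coef_take_poly ?pi0 ?if_same.
Qed.

Lemma coef_digit_poly_eq1 p j : digit_poly p -> p`_j != 0 -> p`_j = 1.
Proof. by move=> /(_ j)[[] ->] //; rewrite eqxx. Qed.

End DigitPoly.

Lemma size_poly_leqS (R : nzSemiRingType) (p : {poly R}) m :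
  (size p <= m.+1)%N -> (size p <= m)%N = (p`_m == 0).
Proof.
move=> size_p; apply/idP/eqP => [/leq_sizeP->//|pm0]; apply/leq_sizeP => j.
by rewrite leq_eqVlt => /orP[/eqP<-//|/(leq_sizeP _ _ size_p)].
Qed.

Section HornerDigitPoly.
Variables (R : numDomainType) (rho : R).
Implicit Types p : {poly R}.

Lemma coef_digit_poly_ge0 p j : digit_poly p -> 0 <= p`_j.
Proof. by move=> /(_ j)[b ->]; rewrite ler0n. Qed.

Lemma coef_digit_poly_le1 p j : digit_poly p -> p`_j <= 1.
Proof. by move=> /(_ j)[[] ->]; rewrite ?lexx ?ler01. Qed.

Lemma sum_expr_ge0 m n : 0 <= rho -> 0 <= \sum_(m <= i < n) rho ^+ i.
Proof. by move=> rho_ge0; apply: sumr_ge0 => i _; rewrite exprn_ge0. Qed.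

Lemma horner_digit_poly_ge0 p : 0 <= rho -> digit_poly p -> 0 <= p.[rho].
Proof.
move=> rho_ge0 digit_p; rewrite horner_coef sumr_ge0 // => i _.
by rewrite mulr_ge0 ?exprn_ge0 ?coef_digit_poly_ge0.
Qed.

Lemma exprn_le_horner p m : 1 <= rho -> digit_poly p -> (m < size p)%N ->
  rho ^+ m <= p.[rho].
Proof.
move=> rho_ge1 digit_p; rewrite horner_coef.
have rho_ge0 := le_trans ler01 rho_ge1.
case size_p: (size p) => [//|n]; rewrite ltnS => mn.
have pn1 : p`_n = 1.
  apply: coef_digit_poly_eq1 => //.
  rewrite -[n]/(n.+1.-1) -size_p -lead_coefE lead_coef_eq0.
  by rewrite -size_poly_gt0 size_p.
rewrite big_ord_recr /= pn1 mul1r (le_trans (ler_weXn2l rho_ge1 mn)) // lerDr.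
by rewrite sumr_ge0 // => i _; rewrite mulr_ge0 ?exprn_ge0 ?coef_digit_poly_ge0.
Qed.

Lemma horner_le_take p i k : 0 <= rho -> digit_poly p ->
  (size p <= k)%N -> (i <= k)%N ->
  p.[rho] <= (take_poly i p).[rho] + \sum_(i <= j < k) rho ^+ j.
Proof.
move=> rho_ge0 digit_p size_p ik.
rewrite (horner_coef_wide _ size_p).
rewrite -(big_mkord xpredT (fun j => p`_j * rho ^+ j)).
rewrite (big_cat_nat (n := i)) //= big_mkord horner_poly lerD2l.
apply: ler_sum => j _.
by rewrite ler_piMl ?exprn_ge0 ?coef_digit_poly_le1.
Qed.

Lemma digit_poly_eqXn p m : 0 < rho -> digit_poly p -> (size p <= m.+1)%N ->
  p`_m != 0 -> p.[rho] = rho ^+ m -> p = 'X^m.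
Proof.
move=> rho_gt0 digit_p size_p pm_neq0.
have pm1 := coef_digit_poly_eq1 digit_p pm_neq0.
rewrite (horner_coef_wide _ size_p) big_ord_recr /= pm1 mul1r.
move=> /(canRL (addrK _)); rewrite subrr => /psumr_eq0P low0.
apply/polyP => j; rewrite coefXn; case: (ltngtP j m) => [jm|mj|->] //.
  have /eqP := low0 (fun i _ => mulr_ge0 (coef_digit_poly_ge0 i digit_p)
    (exprn_ge0 i (ltW rho_gt0))) (Ordinal jm) isT.
  by rewrite mulf_eq0 expf_eq0 (gt_eqF rho_gt0) andbF orbF => /eqP.
by rewrite nth_default ?(leq_trans size_p).
Qed.

End HornerDigitPoly.

Section MaxPoly.
Variables (R : nzSemiRingType) (N : nat).

(* The digit string 1^(N-1) 0 1^(N-1) 0 ... of length k, from the top down. *)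
Definition max_poly (k : nat) : {poly R} :=
  \poly_(j < k) (~~ (N %| k - j)%N)%:R.

Lemma horner_max_poly_small (x : R) k : (k < N)%N ->
  (max_poly k).[x] = \sum_(0 <= j < k) x ^+ j.
Proof.
move=> kN; rewrite horner_poly big_mkord; apply: eq_bigr => j _.
by rewrite gtnNdvd ?mul1r //; have := ltn_ord j; lia.
Qed.

Lemma horner_max_polyD (x : R) k : (0 < N)%N ->
  (max_poly (k + N)).[x] =
  (max_poly k).[x] + \sum_(k.+1 <= j < k + N) x ^+ j.
Proof.
move=> N_gt0; have kN : (k < k + N)%N by lia.
rewrite !horner_poly.
rewrite -(big_mkord xpredT (fun j => (~~ (N %| k + N - j)%N)%:R * x ^+ j)).
rewrite (big_cat_nat (n := k)) ?(ltnW kN) //= big_mkord (big_ltn kN).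
rewrite addKn dvdnn mul0r add0r; congr (_ + _).
  by apply: eq_bigr => j _; rewrite addnC -addnBA ?dvdn_addr // ltnW.
apply: eq_big_nat => j /andP[kj jkN]; rewrite gtnNdvd ?mul1r //; lia.
Qed.

End MaxPoly.

Lemma sum_exprz_sub (R : unitRingType) (x : R) r N :
  \sum_(r.+1 <= i < N.+1) x ^ (r%:Z - i%:Z) =
  \sum_(1 <= k < (N - r).+1) (x ^+ k)^-1.
Proof.
rewrite [RHS]big_add1 [LHS]big_add1 /= -{1}[r]add0n big_addn.
by apply: eq_bigr => i _; rewrite exprnN; congr (_ ^ _); lia.
Qed.

Section NbonacciIdentities.
Variables (R : fieldType) (N : nat) (rho : R).
Hypothesis N_gt0 : (0 < N)%N.
Hypothesis expr_rhoN : rho ^+ N = \sum_(0 <= i < N) rho ^+ i.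

Lemma nbonacci_neq0 : rho != 0.
Proof.
apply/eqP => rho0; have /eqP := expr_rhoN; rewrite rho0 expr0n gtn_eqF //.
rewrite big_ltn // expr0 big_nat big1 => [|i /andP[i_gt0 _]].
  by rewrite addr0 eq_sym oner_eq0.
by rewrite expr0n gtn_eqF.
Qed.

Lemma nbonacci_expD k : rho ^+ (k + N) = \sum_(k <= j < k + N) rho ^+ j.
Proof.
rewrite exprD expr_rhoN mulr_sumr -{2}[k]add0n big_addn addKn.
by apply: eq_bigr => i _; rewrite -exprD addnC.
Qed.

Lemma nbonacci_sub_sum n k : (n + k)%N = N ->
  rho ^+ k - \sum_(0 <= j < k) rho ^+ j = \sum_(1 <= i < n.+1) (rho ^+ i)^-1.
Proof.
elim: n k => [k kN|n IHn k nkN].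
  by rewrite [RHS]big_geq // -[k]add0n kN -expr_rhoN subrr.
have rho_neq0 := nbonacci_neq0.
apply: (mulfI rho_neq0); rewrite mulrBr -exprS !mulr_sumr.
have -> : \sum_(0 <= j < k) rho * rho ^+ j = \sum_(0 <= j < k.+1) rho ^+ j - 1.
  rewrite big_nat_recl // expr0 addrC addKr.
  by apply: eq_bigr => j _; rewrite exprS.
rewrite opprB addrA addrAC IHn ?addnS // addrC.
rewrite [RHS]big_ltn // expr1 mulfV // [in RHS]big_add1.
by congr (1 + _); apply: eq_bigr => i _; rewrite exprS invfM mulVKf.
Qed.

Lemma sub_horner_max_poly k :
  rho ^+ k - (max_poly R N k).[rho] =
  \sum_(1 <= i < (N - k %% N).+1) (rho ^+ i)^-1.
Proof.
elim/ltn_ind: k => k IHk; have [kN|Nk] := ltnP k N.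
  rewrite modn_small // horner_max_poly_small //.
  by rewrite (nbonacci_sub_sum (subnK (ltnW kN))).
rewrite -(subnK Nk) modnDr -IHk; last by lia.
rewrite (horner_max_polyD _ _ N_gt0) nbonacci_expD big_ltn; last by lia.
by rewrite opprD addrACA subrr addr0.
Qed.

End NbonacciIdentities.

Section NbonacciBounds.
Variables (R : realFieldType) (N : nat) (rho : R).
Hypotheses (N_gt1 : (1 < N)%N) (rho_gt0 : 0 < rho).
Hypothesis expr_rhoN : rho ^+ N = \sum_(0 <= i < N) rho ^+ i.
Implicit Types p : {poly R}.

Let N_gt0 : (0 < N)%N := ltnW N_gt1.
Let rho_ge0 : 0 <= rho := ltW rho_gt0.

Lemma nbonacci_gt1 : 1 < rho.
Proof.
rewrite ltNge; apply/negP => rho_le1.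
have : rho ^+ N <= 1 by rewrite exprn_ile1.
rewrite expr_rhoN big_ltn // big_ltn // expr0 expr1.
by have := sum_expr_ge0 2 N rho_ge0; have := rho_gt0; lra.
Qed.

Lemma horner_max_poly_lt k : (max_poly R N k).[rho] < rho ^+ k.
Proof.
have kN : (k %% N < N)%N by rewrite ltn_mod.
rewrite -subr_gt0 (sub_horner_max_poly N_gt0 expr_rhoN).
rewrite big_ltn ?ltnS ?subn_gt0 // ltr_wpDr ?invr_gt0 ?exprn_gt0 //.
by apply: sumr_ge0 => i _; rewrite invr_ge0 exprn_ge0.
Qed.

Lemma horner_max_poly_leD k i : (k <= i)%N ->
  (max_poly R N i).[rho] <=
  (max_poly R N k).[rho] + \sum_(k.+1 <= j < i.+1) rho ^+ j.
Proof.
rewrite leq_eqVlt => /orP[/eqP<-|ki]; first by rewrite big_geq ?addr0.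
rewrite big_nat_recr //=.
have := sum_expr_ge0 k.+1 i rho_ge0.
have : 0 <= (max_poly R N k).[rho].
  exact/horner_digit_poly_ge0/digit_poly_poly.
by have := horner_max_poly_lt i; lra.
Qed.

(* Cut p at a zero digit i among its N leading ones: the lower i is, the weaker
   the resulting bound, and the extreme case i = k - N is horner_max_polyD. *)
Lemma horner_admissible_le p k : admissible N p -> (size p <= k)%N ->
  p.[rho] <= (max_poly R N k).[rho].
Proof.
elim/ltn_ind: k p => k IHk p adm_p size_p.
have [digit_p zero_p] := adm_p.
have [kN|Nk] := ltnP k N.
  rewrite horner_max_poly_small //.
  have := horner_le_take rho_ge0 digit_p size_p (leq0n k).
  by rewrite take_poly0l horner0 add0r.
have [i /andP[ki iN] pi0] := zero_p (k - N)%N.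
rewrite subnK // in iN.
have take_iS : take_poly i.+1 p = take_poly i p.
  apply/polyP => j; rewrite !coef_take_poly ltnS leq_eqVlt.
  by case: eqP => [->|//]; rewrite pi0 if_same.
apply: le_trans (horner_le_take rho_ge0 digit_p size_p iN) _.
rewrite take_iS -(subnK Nk) (horner_max_polyD _ _ N_gt0) subnK //.
rewrite (big_cat_nat (n := i.+1) (m := (k - N).+1)) //= addrA lerD2r.
apply: le_trans (horner_max_poly_leD ki).
by apply: IHk; rewrite ?size_take_poly //; apply: admissible_take.
Qed.

Lemma horner_admissible_lt p k : admissible N p ->
  (p.[rho] < rho ^+ k) = (size p <= k)%N.
Proof.
move=> adm_p; apply/idP/idP => [|size_p]; last first.
  exact: le_lt_trans (horner_admissible_le adm_p size_p) (horner_max_poly_lt k).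
rewrite ltNge; apply: contraR; rewrite -ltnNge.
exact/exprn_le_horner/(proj1 adm_p)/ltW/nbonacci_gt1.
Qed.

End NbonacciBounds.

Section RhoIntegers.
Variables (R : realType) (rho : R).
Implicit Types (p q : {poly R}) (x : R).

Lemma formal_sumE n (c : nat -> bool) :
  formal_sum R n c = \poly_(j < n.+1) (c (n - j)%N)%:R.
Proof.
rewrite poly_def (reindex_inj rev_ord_inj) /=; apply: eq_bigr => i _.
by rewrite subSS subKn // -ltnS.
Qed.

Lemma sub_common_terms_above p q m (z := common_terms_above p q m) :
  digit_poly p -> drop_poly m.+1 p = drop_poly m.+1 q ->
  p - z = take_poly m.+1 p /\ q - z = take_poly m.+1 q.
Proof.
move=> digit_p drop_pq; have zE : z = drop_poly m.+1 p * 'X^(m.+1).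
  rewrite /z /common_terms_above -sum_drop_poly big_mkcond /=.
  apply: eq_big_nat => j /andP[mj _].
  have <- : p`_j = q`_j by rewrite -(subnK mj) -!coef_drop_poly drop_pq.
  have [[] ->] := digit_p j; first by rewrite eqxx scale1r.
  by rewrite eq_sym oner_eq0 scale0r.
split; first by rewrite -{1}(poly_take_drop m.+1 p) zE addrK.
by rewrite -{1}(poly_take_drop m.+1 q) zE drop_pq addrK.
Qed.

Lemma normal_form_admissible N x p : (0 < N)%N -> normal_form_of N rho x p ->
  admissible N p /\ x = p.[rho].
Proof.
move=> N_gt0 [n [c [[_ _ zero_c] -> ->]]]; split=> //.
split=> [|j]; rewrite formal_sumE; first exact: digit_poly_poly.
have [jN|jN] := leqP (j + N) n.+1.
  have [i ijN ci0] := zero_c (n.+1 - (j + N))%N.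
  exists (n - i)%N; first lia.
  by rewrite coef_poly subKn ?ci0 ?if_same //; lia.
by exists (j + N).-1; [lia|rewrite coef_poly ifF //; lia].
Qed.

Lemma root_nbonacci_poly N :
  root (nbonacci_poly R N) rho = (rho ^+ N == \sum_(0 <= i < N) rho ^+ i).
Proof.
rewrite rootE hornerD hornerN hornerXn horner_sum subr_eq0 big_mkord.
by under eq_bigr do rewrite hornerXn.
Qed.

Hypothesis rho_ge0 : 0 <= rho.

Lemma rho_integerP x :
  rho_integer rho x <-> exists2 p, digit_poly p & x = p.[rho].
Proof.
split=> [[_ [n [c ->]]]|[p digit_p ->]].
  exists (formal_sum R n c).
    by rewrite formal_sumE; apply: digit_poly_poly.
  by rewrite horner_sum; apply: eq_bigr => i _; rewrite hornerZ hornerXn.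
split; first exact: horner_digit_poly_ge0.
exists (size p), (fun i => p`_(size p - i) == 1).
rewrite (horner_coef_wide _ (leqnSn _)) (reindex_inj rev_ord_inj) /=.
apply: eq_bigr => i _; rewrite subSS; congr (_ * _).
by have [[] ->] := digit_p (size p - i)%N; rewrite ?eqxx // eq_sym oner_eq0.
Qed.

Lemma rho_integer_horner p : digit_poly p -> rho_integer rho p.[rho].
Proof. by move=> digit_p; apply/rho_integerP; exists p. Qed.

Lemma rho_integer_exprn m : rho_integer rho (rho ^+ m).
Proof. by rewrite -hornerXn; apply/rho_integer_horner/digit_polyXn. Qed.

End RhoIntegers.

Section Consecutive.
Variables (R : realType) (rho : R).
Implicit Types (p q : {poly R}) (x y w : R).

Lemma consecutive_le y x w :
  consecutive rho y x -> rho_integer rho w -> w < x -> w <= y.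
Proof.
move=> [_ _ _ yx_min] w_int wx; rewrite leNgt; apply/negP => yw.
by apply: (yx_min w w_int); rewrite yw.
Qed.

Lemma consecutive_ge y x w :
  consecutive rho y x -> rho_integer rho w -> y < w -> x <= w.
Proof.
move=> [_ _ _ yx_min] w_int yw; rewrite leNgt; apply/negP => wx.
by apply: (yx_min w w_int); rewrite yw.
Qed.

Hypothesis rho_ge1 : 1 <= rho.

Let rho_ge0 : 0 <= rho := le_trans ler01 rho_ge1.

Lemma consecutive0_eq1 x : consecutive rho 0 x -> x = 1.
Proof.
move=> hx; have [_ /(rho_integerP rho_ge0)[p digit_p xE] x_gt0 _] := hx.
apply/eqP; rewrite eq_le; apply/andP; split.
  apply: (consecutive_ge hx _ ltr01); rewrite -(expr0 rho).
  exact: rho_integer_exprn.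
rewrite xE -(expr0 rho) exprn_le_horner // size_poly_gt0.
by apply: contraTneq x_gt0 => p0; rewrite xE p0 horner0 ltxx.
Qed.

(* A rho-integer below rho ^+ m has no digit at an exponent >= m, so it can
   replace the last m digits of another one. *)
Lemma consecutive_take p q m : digit_poly p -> digit_poly q ->
  (take_poly m p).[rho] < rho ^+ m -> drop_poly m p = drop_poly m q ->
  consecutive rho q.[rho] p.[rho] ->
  consecutive rho (take_poly m q).[rho] (take_poly m p).[rho].
Proof.
move=> digit_p digit_q take_p_lt drop_pq hpq; have [_ _ qp _] := hpq.
have take_int r : digit_poly r -> rho_integer rho (take_poly m r).[rho].
  by move=> digit_r; apply/(rho_integer_horner rho_ge0)/digit_poly_take.
have hornerE r : drop_poly m r = drop_poly m p ->
    r.[rho] = (take_poly m r).[rho] + (drop_poly m p).[rho] * rho ^+ m.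
  by move=> <-; rewrite -{1}(poly_take_drop m r) hornerD hornerM hornerXn.
have pE := hornerE p erefl; have qE := hornerE q (esym drop_pq).
split; [exact: take_int|exact: take_int|by move: qp; rewrite pE qE ltrD2r|].
move=> w /(rho_integerP rho_ge0)[r digit_r ->] /andP[qr rp].
have size_r : (size r <= m)%N.
  rewrite leqNgt; apply/negP => /(exprn_le_horner rho_ge1 digit_r).
  by rewrite leNgt (lt_trans rp).
have s_int : rho_integer rho (r + drop_poly m p * 'X^m).[rho].
  apply/(rho_integer_horner rho_ge0)/digit_poly_addMXn => // j.
  by rewrite coef_drop_poly.
have := consecutive_le hpq s_int.
by rewrite pE qE hornerD hornerM hornerXn ltrD2r lerD2r leNgt qr => /(_ rp).
Qed.

End Consecutive.

Section NbonacciIntegers.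
Variables (R : realType) (N : nat) (rho : R).
Hypotheses (N_gt1 : (1 < N)%N) (rho_gt0 : 0 < rho).
Hypothesis rho_root : root (nbonacci_poly R N) rho.
Implicit Types p q : {poly R}.

Let expr_rhoN : rho ^+ N = \sum_(0 <= i < N) rho ^+ i.
Proof. by apply/eqP; rewrite -root_nbonacci_poly. Qed.

Let rho_ge0 : 0 <= rho := ltW rho_gt0.
Let rho_gt1 : 1 < rho := nbonacci_gt1 N_gt1 rho_gt0 expr_rhoN.

Lemma consecutive_eqXn p q m : admissible N p -> admissible N q ->
  (size p <= m.+1)%N -> (size q <= m.+1)%N -> p`_m <> q`_m ->
  consecutive rho q.[rho] p.[rho] -> p = 'X^m.
Proof.
move=> adm_p adm_q size_p size_q pq_m hpq; have [_ _ qp _] := hpq.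
have [digit_p _] := adm_p; have [digit_q _] := adm_q.
have lt_exprE r : admissible N r -> (size r <= m.+1)%N ->
    (r.[rho] < rho ^+ m) = (r`_m == 0).
  by move=> *; rewrite (horner_admissible_lt N_gt1) // size_poly_leqS.
have pm_neq0 : p`_m != 0.
  apply: contra_not_neq pq_m => pm0; rewrite pm0; apply/esym/eqP.
  by rewrite -lt_exprE // (lt_trans qp) // lt_exprE // pm0.
have qm0 : q`_m = 0.
  have pm1 := coef_digit_poly_eq1 digit_p pm_neq0.
  apply/eqP; apply: contra_notT pq_m => /(coef_digit_poly_eq1 digit_q) ->.
  exact: pm1.
apply: (digit_poly_eqXn rho_gt0 digit_p size_p pm_neq0).
apply/eqP; rewrite eq_le [rho ^+ m <= _]leNgt lt_exprE // pm_neq0 andbT.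
apply: (consecutive_ge hpq); first exact: rho_integer_exprn.
by rewrite lt_exprE // qm0.
Qed.

Lemma consecutive_sub_common_terms p q m (z := common_terms_above p q m) :
  admissible N p -> admissible N q -> largest_difference p q m ->
  consecutive rho q.[rho] p.[rho] ->
  [/\ p - z = 'X^m, admissible N (q - z) &
      consecutive rho (q - z).[rho] (rho ^+ m)].
Proof.
move=> adm_p adm_q [pq_m eq_pq] hpq.
have [digit_p _] := adm_p; have [digit_q _] := adm_q.
have drop_pq : drop_poly m.+1 p = drop_poly m.+1 q.
  by apply/polyP => j; rewrite !coef_drop_poly eq_pq // addnS ltnS leq_addl.
have [-> ->] := sub_common_terms_above digit_p drop_pq.
have adm_tp := admissible_take m.+1 adm_p.
have adm_tq := admissible_take m.+1 adm_q.
have tails : consecutive rho (take_poly m.+1 q).[rho] (take_poly m.+1 p).[rho].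
  apply: consecutive_take => //; first exact: ltW.
  by rewrite (horner_admissible_lt N_gt1) // size_take_poly.
have tpE : take_poly m.+1 p = 'X^m.
  apply: consecutive_eqXn adm_tp adm_tq _ _ _ tails; rewrite ?size_take_poly //.
  by rewrite !coef_take_poly ltnSn.
by move: tails; rewrite tpE hornerXn.
Qed.

Section PredExprn.
Variables (q : {poly R}) (m : nat).
Hypothesis adm_q : admissible N q.
Hypothesis pred_q : consecutive rho q.[rho] (rho ^+ m).

Let size_q : (size q <= m)%N.
Proof.
have [_ _ q_lt _] := pred_q.
by rewrite -(horner_admissible_lt N_gt1 rho_gt0 expr_rhoN).
Qed.

Lemma consecutive_exprn_horner : q.[rho] = (max_poly R N m).[rho].
Proof.
apply/eqP; rewrite eq_le; apply/andP; split.
  exact: (horner_admissible_le N_gt1).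
apply: (consecutive_le pred_q); last exact: (horner_max_poly_lt N_gt1).
exact/(rho_integer_horner rho_ge0)/digit_poly_poly.
Qed.

Lemma consecutive_exprn_size : q != 0 -> size q = m.
Proof.
move=> q_neq0.
have m_gt0 : (0 < m)%N by rewrite (leq_trans _ size_q) // size_poly_gt0.
apply/eqP; rewrite eqn_leq size_q -(prednK m_gt0) ltnNge.
rewrite -(horner_admissible_lt N_gt1 rho_gt0 expr_rhoN) // -leNgt.
apply: (consecutive_le pred_q); first exact: rho_integer_exprn.
by rewrite ltr_eXn2l // prednK.
Qed.

End PredExprn.

End NbonacciIntegers.

Theorem theorem3p13 (R : realType) (N : nat) (hN : (2 <= N)%N) (rho : R)
    (rho_gt0 : 0 < rho) (rho_root : root (nbonacci_poly R N) rho)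
    (x y : R) (hxy : consecutive rho y x) :
  (y = 0 -> x = 1) /\
  (y <> 0 ->
   forall (px py : {poly R}) (m : nat),
     normal_form_of N rho x px -> normal_form_of N rho y py ->
     largest_difference px py m ->
     let z := common_terms_above px py m in
     let tx := px - z in
     let ty := py - z in
     (ty = 0 -> tx = 1) /\
     (ty <> 0 ->
      (deg ty < deg tx)%N /\
      (let n := deg ty in
       let r := (n.+1 %% N)%N in
       x - y = \sum_(r.+1 <= i < N.+1) rho ^ (r%:Z - i%:Z) /\
       \sum_(r.+1 <= i < N.+1) rho ^ (r%:Z - i%:Z)
         = \sum_(1 <= k < (N - r).+1) (rho ^+ k)^-1))).
Proof.
have := rho_root; rewrite root_nbonacci_poly => /eqP expr_rhoN.
have rho_gt1 := nbonacci_gt1 hN rho_gt0 expr_rhoN.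
split=> [y0|_ px py m nf_px nf_py pxy_m z tx ty].
  by apply: (consecutive0_eq1 (ltW rho_gt1)); rewrite -y0.
have [adm_px xE] := normal_form_admissible (ltnW hN) nf_px.
have [adm_py yE] := normal_form_admissible (ltnW hN) nf_py.
move: hxy; rewrite xE yE => hpq.
have [txE adm_ty pred_ty] :=
  consecutive_sub_common_terms hN rho_gt0 rho_root adm_px adm_py pxy_m hpq.
rewrite -/z -/tx -/ty in txE adm_ty pred_ty.
split=> [ty0|/eqP ty_neq0].
  suff m0 : m = 0%N by rewrite txE m0.
  move: pred_ty; rewrite ty0 horner0 => /(consecutive0_eq1 (ltW rho_gt1))/eqP.
  by apply: contraTeq => m_neq0; rewrite gt_eqF // exprn_egt1.
have size_ty :=
  consecutive_exprn_size hN rho_gt0 rho_root adm_ty pred_ty ty_neq0.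
have m_gt0 : (0 < m)%N by rewrite -size_ty size_poly_gt0.
rewrite /deg txE size_polyXn size_ty prednK // leqnn /= sum_exprz_sub.
split=> //; split=> //; rewrite -(sub_horner_max_poly (ltnW hN) expr_rhoN).
rewrite -(consecutive_exprn_horner hN rho_gt0 rho_root adm_ty pred_ty).
by rewrite -hornerXn -txE -!hornerN -!hornerD /tx /ty opprB addrA subrK.
Qed.
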